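(* For every integer $n\ge 4$, the number $v_{n,2}$ of vertices of $G(n)$ that are contained in some $2$-cycle equals $2n+2$.
   Context: For a sequence of distinct integers $c_1\cdots c_t$, $\mathrm{st}(c_1\cdots c_t)$ is the unique permutation $d_1\cdots d_t$ of $\{1,\dots,t\}$ with $d_i<d_j$ iff $c_i<c_j$. $G(n)$ is the directed multigraph whose vertices are the permutations of $\{1,\dots,n\}$ (one-line notation) and whose edges are the permutations $c_1\cdots c_{n+1}$ of $\{1,\dots,n+1\}$, the edge $c_1\cdots c_{n+1}$ going from $\mathrm{st}(c_1\cdots c_n)$ to $\mathrm{st}(c_2\cdots c_{n+1})$; so there is an edge from $x_1\cdots x_n$ to $w_1\cdots w_n$ iff $\mathrm{st}(x_2\cdots x_n)=\mathrm{st}(w_1\cdots w_{n-1})$. A $2$-cycle is a pair of distinct vertices $\mathbf a,\mathbf b$ together with an edge from $\mathbf a$ to $\mathbf b$ and an edge from $\mathbf b$ to $\mathbf a$. *)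

(* Defs.v *)
From mathcomp Require Import all_boot all_fingroup.

Set Implicit Arguments.
Unset Strict Implicit.
Unset Printing Implicit Defensive.

(* Each entry is replaced by its rank, counted from 1; st_iff shows that, for
   distinct entries, this is the only permutation of {1, ..., t} ordered as c. *)
Definition st (c : seq nat) : seq nat :=
  [seq count (fun y => y <= x) c | x <- c].

Definition same_order (c d : seq nat) : Prop :=
  forall i j, i < size c -> j < size c ->
    (nth 0 d i < nth 0 d j) = (nth 0 c i < nth 0 c j).

Lemma count_le_lt (c : seq nat) (x y : nat) : y \in c ->
  (count (fun z => z <= x) c < count (fun z => z <= y) c) = (x < y).
Proof.
move=> yc; case: (ltnP x y) => xy; last first.
  by apply/negbTE; rewrite -leqNgt; apply: sub_count => z /leq_trans; apply.
have disj z : (z <= x) && (z == y) = false.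
  by apply/negbTE/andP => -[zx /eqP zy]; rewrite -zy ltnNge zx in xy.
have := count_predUI (fun z => z <= x) (pred1 y) c.
rewrite (@eq_count _ (predI _ _) pred0) // count_pred0 addn0 => eqU.
apply: (@leq_trans (count (predU (fun z => z <= x) (pred1 y)) c)).
  by rewrite eqU -addn1 leq_add2l -has_count has_pred1.
apply: sub_count => z /= /orP[zx|/eqP-> //].
exact: ltnW (leq_ltn_trans zx xy).
Qed.

Lemma st_same_order (c : seq nat) : same_order c (st c).
Proof.
move=> i j ic jc; rewrite !(nth_map 0) //.
exact/count_le_lt/mem_nth.
Qed.

Lemma st_perm (c : seq nat) : uniq c -> perm_eq (st c) (iota 1 (size c)).
Proof.
move=> uc; have ust : uniq (st c).
  rewrite map_inj_in_uniq // => x y xc yc exy.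
  by case: (ltngtP x y) => //; rewrite -(@count_le_lt c) // exy ltnn.
apply: uniq_perm (iota_uniq _ _) _ => //.
suff sub : {subset st c <= iota 1 (size c)}.
  by apply: (uniq_min_size ust sub _).2; rewrite size_iota size_map.
move=> _ /mapP[x xc ->]; rewrite mem_iota add1n ltnS count_size andbT.
by rewrite -has_count; apply/hasP; exists x.
Qed.

Lemma st_iff (c d : seq nat) : uniq c ->
  d = st c <-> perm_eq d (iota 1 (size c)) /\ same_order c d.
Proof.
move=> uc; split=> [->|[pd od]].
  by split; [exact: st_perm | exact: st_same_order].
have sd : size d = size c by rewrite (perm_size pd) size_iota.
apply: (@eq_from_nth _ 0); first by rewrite size_map.
move=> i; rewrite sd => ic; rewrite (nth_map 0) //.
have di : 0 < nth 0 d i < (size c).+1.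
  by rewrite -(mem_iota 1) -(perm_mem pd) mem_nth // sd.
have -> : nth 0 d i = count (fun y => y <= nth 0 d i) d.
  rewrite (seq.permP pd) -size_filter; have /andP[d0 dc] := di.
  rewrite -[in iota _ _](subnKC (dc : nth 0 d i <= size c)) iotaD.
  rewrite filter_cat size_cat !size_filter.
  rewrite (@eq_in_count _ _ predT); last first.
    by move=> z; rewrite mem_iota add1n ltnS => /andP[].
  rewrite count_predT size_iota (@eq_in_count _ _ pred0) ?count_pred0 ?addn0 //.
  by move=> z; rewrite mem_iota add1n => /andP[/= dz _]; rewrite leqNgt dz.
rewrite -(mkseq_nth 0 c) -[in count _ d](mkseq_nth 0 d) sd !count_map.
apply: eq_in_count => j; rewrite mem_iota add0n => /= jc.
by rewrite !nth_mkseq // leqNgt od // -leqNgt.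
Qed.

(* One-line notation, with values in {1, ..., n}: 'S_n permutes {0, ..., n-1}. *)
Definition word (n : nat) (s : 'S_n) : seq nat :=
  [seq (val (s i)).+1 | i <- enum 'I_n].

(* The vertices of G(n) are the elements of 'S_n, its edges those of 'S_n.+1. *)
Definition is_edge (n : nat) (e : 'S_n.+1) (a b : 'S_n) : bool :=
  (st (take n (word e)) == word a) && (st (behead (word e)) == word b).

Definition two_cycle (n : nat) (a b : 'S_n) : bool :=
  [&& a != b, [exists e, is_edge e a b] & [exists e, is_edge e b a]].

Definition v2 (n : nat) : nat := #|[set a : 'S_n | [exists b, two_cycle a b]]|.

(* Main.v *)
(** A vertex a lies on a closed walk a -> b -> a exactly when the relative order
    of two entries of a is unchanged by moving both positions by two.  Then the
    entries at even positions are monotone, as are those at odd positions.  If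
    both increase, the order is determined by the threshold above which a
    difference j - i, with i even and j odd, forces a_i < a_j: n possibilities.
    If the evens increase and the odds decrease, one class lies entirely below
    the other: 2 possibilities.  Complementing all values doubles the count to
    2 (n + 2).  The walk degenerates to b = a exactly for the 2 monotone words.
    Each remaining pattern is the order of the first n terms of an integer
    sequence k(0), k(1), ..., k(n+1) whose order is invariant under shifting by
    two, and the windows of k of length n and n + 1 are the vertices and edges
    of the required 2-cycle. *)

Require Import Defs.
From mathcomp Require Import all_boot all_fingroup.
From mathcomp Require Import all_order all_algebra zify.

Set Implicit Arguments.
Unset Strict Implicit.
Unset Printing Implicit Defensive.

Import Order.TTheory GRing.Theory Num.Theory.

(** * Words and edges of G(n) as order conditions on entries *)

Definition ent (n : nat) (a : 'S_n) (i : nat) : nat := nth 0 (word a) i.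

Lemma size_word (n : nat) (a : 'S_n) : size (word a) = n.
Proof. by rewrite size_map size_enum_ord. Qed.

Lemma ent_ord (n : nat) (a : 'S_n) (i : 'I_n) : ent a i = (a i).+1.
Proof.
by rewrite /ent (nth_map i) ?size_enum_ord // nth_ord_enum.
Qed.

Lemma word_inj (n : nat) : injective (@word n).
Proof.
move=> a b eab; apply/permP => i; apply: val_inj; apply: succn_inj.
by rewrite -!ent_ord /ent eab.
Qed.

Lemma ent_inj (n : nat) (a : 'S_n) (i j : nat) :
  i < n -> j < n -> ent a i = ent a j -> i = j.
Proof.
move=> hi hj; rewrite (ent_ord a (Ordinal hi)) (ent_ord a (Ordinal hj)).
by move=> /succn_inj /val_inj /perm_inj /(congr1 val).
Qed.

Lemma uniq_word (n : nat) (a : 'S_n) : uniq (word a).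
Proof.
by apply/(uniqP 0) => i j; rewrite !inE size_word; apply: ent_inj.
Qed.

Lemma perm_word (n : nat) (a : 'S_n) : perm_eq (word a) (iota 1 n).
Proof.
have sub : {subset word a <= iota 1 n}.
  by move=> _ /mapP[i _ ->]; rewrite mem_iota add1n !ltnS ltn_ord.
apply: uniq_perm (uniq_word a) (iota_uniq _ _) _.
by apply: (uniq_min_size (uniq_word a) sub _).2; rewrite size_iota size_word.
Qed.

(** A [word] already lists 1, ..., n, so of the two conditions in [st_iff] only the order condition
    remains. *)
Lemma st_eq_word (n : nat) (c : seq nat) (a : 'S_n) :
  uniq c -> size c = n ->
  (st c == word a) <->
  (forall i j, i < n -> j < n -> (ent a i < ent a j) = (nth 0 c i < nth 0 c j)).
Proof.
move=> uc sc; split=> [/eqP/esym/(st_iff _ uc)[_ H] i j|H].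
  by move=> hi hj; apply: H; rewrite sc.
apply/eqP/esym/(st_iff _ uc); split; first by rewrite sc perm_word.
by move=> i j hi hj; apply: H; rewrite -sc.
Qed.

Lemma is_edgeP (n : nat) (e : 'S_n.+1) (a b : 'S_n) :
  is_edge e a b <->
  (forall i j, i < n -> j < n -> (ent a i < ent a j) = (ent e i < ent e j)) /\
  (forall i j, i < n -> j < n -> (ent b i < ent b j) = (ent e i.+1 < ent e j.+1)).
Proof.
have u1 : uniq (take n (word e)) by rewrite take_uniq ?uniq_word.
have s1 : size (take n (word e)) = n by rewrite size_takel // size_word.
have u2 : uniq (behead (word e)) by rewrite -drop1 drop_uniq ?uniq_word.
have s2 : size (behead (word e)) = n by rewrite size_behead size_word.
rewrite /is_edge; split=> [/andP[/(st_eq_word _ u1 s1) H1 /(st_eq_word _ u2 s2) H2]|[H1 H2]].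
  split=> i j hi hj; first by rewrite H1 // !nth_take.
  by rewrite H2 // !nth_behead.
apply/andP; split.
  by apply/(st_eq_word _ u1 s1) => i j hi hj; rewrite H1 // !nth_take.
by apply/(st_eq_word _ u2 s2) => i j hi hj; rewrite H2 // !nth_behead.
Qed.

(** * Permutations ordered like an integer sequence *)

Definition follows (n : nat) (k : nat -> int) (a : 'S_n) : Prop :=
  forall i j, i < n -> j < n -> (ent a i < ent a j) = (k i < k j)%R.

Lemma follows_unique (n : nat) (k : nat -> int) (a b : 'S_n) :
  follows k a -> follows k b -> a = b.
Proof.
move=> ha hb; apply: word_inj; apply/eqP.
have /eqP <- : st (word b) == word b.
  by apply/(st_eq_word _ (uniq_word b) (size_word b)).
rewrite eq_sym; apply/(st_eq_word _ (uniq_word b) (size_word b)) => i j hi hj.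
by rewrite ha // -hb.
Qed.

(** Send each index to its rank, the number of indices with a smaller term. *)
Lemma follows_exists (n : nat) (k : nat -> int) :
  {in gtn n &, injective k} -> exists a : 'S_n, follows k a.
Proof.
move=> kI; pose below (i : 'I_n) := [set j : 'I_n | k j < k i]%R.
have below_lt i : #|below i| < n.
  rewrite -[X in _ < X]card_ord -cardsT; apply: proper_card.
  by apply/properP; split; [exact: subsetT|exists i; rewrite ?inE ?ltxx].
have below_mono i j : (#|below i| < #|below j|) = (k i < k j)%R.
  have sub (x y : 'I_n) : (k x <= k y)%R -> #|below x| <= #|below y|.
    move=> xy; apply/subset_leq_card/subsetP => z; rewrite !inE => /lt_le_trans.
    exact.
  case: (ltP (k i) (k j)) => [ij|/sub]; last by rewrite ltnNge => ->.
  apply: proper_card; apply/properP; split.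
    by apply/subsetP => z; rewrite !inE => /lt_trans; apply.
  by exists i; rewrite !inE ?ltxx.
pose f i := Ordinal (below_lt i).
have fI : injective f.
  move=> i j /(congr1 val) /= eij; apply/val_inj/kI; rewrite ?inE ?ltn_ord //.
  by apply: le_anti; rewrite !leNgt -!below_mono eij ltnn.
exists (perm fI) => i j hi hj.
rewrite (ent_ord _ (Ordinal hi)) (ent_ord _ (Ordinal hj)) ltnS !permE /=.
exact: below_mono.
Qed.

(** * Shift-invariant orders and their relation to 2-cycles *)

Definition shift_inv (c n : nat) : {set 'S_n} :=
  [set a | [forall i : 'I_n, forall j : 'I_n, (i + c < n) ==> (j + c < n) ==>
     ((ent a (i + c) < ent a (j + c)) == (ent a i < ent a j))]].

Lemma shift_invP (c n : nat) (a : 'S_n) :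
  reflect (forall i j, i + c < n -> j + c < n ->
             (ent a (i + c) < ent a (j + c)) = (ent a i < ent a j))
          (a \in shift_inv c n).
Proof.
rewrite inE; apply: (iffP forallP) => [H i j hi hj|H i]; last first.
  by apply/forallP => j; apply/implyP => hi; apply/implyP => hj; rewrite H.
have hi' : i < n by apply: leq_ltn_trans hi; apply: leq_addr.
have hj' : j < n by apply: leq_ltn_trans hj; apply: leq_addr.
by have /forallP/(_ (Ordinal hj')) := H (Ordinal hi'); rewrite /= hi hj => /eqP.
Qed.

Lemma follows_shift_inv (c n : nat) (k : nat -> int) (a : 'S_n) :
  (forall i j, i + c < n -> j + c < n ->
     (k (i + c)%N < k (j + c)%N)%R = (k i < k j)%R) ->
  follows k a -> a \in shift_inv c n.
Proof.
by move=> hk ha; apply/shift_invP => i j hi hj; rewrite !ha ?hk //; lia.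
Qed.

Lemma incr_lt (m : nat) (y : nat -> int) :
  (forall i, i.+1 < m -> (y i < y i.+1)%R) ->
  forall i j, i < m -> j < m -> (y i < y j)%R = (i < j).
Proof.
move=> hy.
have lt i j : i < j -> j < m -> (y i < y j)%R.
  elim: j => // j IH; rewrite ltnS leq_eqVlt => /orP[/eqP->|ij] hj.
    exact: hy.
  by apply: lt_trans (hy _ hj); apply: IH => //; apply: ltnW.
move=> i j hi hj; case: (ltngtP i j) => [ij|ji|->]; last by rewrite ltxx.
  exact: lt.
by apply/negbTE; rewrite -leNgt ltW // lt.
Qed.

(** Negation models the complement of all values, so that one direction of monotonicity can be fixed
    in advance. *)
Definition signed (s : bool) (k : nat -> int) (i : nat) : int :=
  if s then (- k i)%R else k i.

Lemma signed_lt (s : bool) (k : nat -> int) (i j : nat) :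
  (signed s k i < signed s k j)%R = if s then (k j < k i)%R else (k i < k j)%R.
Proof. by case: s => //=; rewrite ltrN2. Qed.

Lemma signed_follows (n : nat) (s : bool) (k : nat -> int) (a : 'S_n) :
  (forall i j, i < n -> j < n ->
     (signed s (fun i => ent a i) i < signed s (fun i => ent a i) j)%R
     = (k i < k j)%R) ->
  follows (signed s k) a.
Proof.
move=> H i j hi hj; rewrite signed_lt; case: s H => H; rewrite -H //= /signed.
  by rewrite ltrN2 ltz_nat.
Qed.

(** The comparison of the first two entries propagates to all neighbours, so the word is
    monotone. *)
Lemma shift_inv1_follows (n : nat) (a : 'S_n) : a \in shift_inv 1 n ->
  exists s, follows (signed s Posz) a.
Proof.
move=> /shift_invP inv1; exists (ent a 1 < ent a 0).
apply: signed_follows => i j; move: i j; apply: incr_lt.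
elim=> [|i IH] hi.
  rewrite signed_lt !ltz_nat; case: (ltngtP (ent a 1) (ent a 0)) => // e.
  by have := ent_inj hi (ltnW hi) e.
have := IH (ltnW hi); rewrite !signed_lt !ltz_nat.
by rewrite -(inv1 i i.+1) -1?(inv1 i.+1 i) ?addn1 //; lia.
Qed.

(** Each edge moves comparisons by one position, so both together move them by two. A monotone [a]
    would force [b] to be monotone in the same direction, hence equal to [a]. *)
Lemma two_cycle_shift_inv (n : nat) (a b : 'S_n) : 2 < n ->
  two_cycle a b -> a \in shift_inv 2 n /\ a \notin shift_inv 1 n.
Proof.
move=> n3.
case/and3P => nab /existsP[e /is_edgeP[e1 e2]] /existsP[f /is_edgeP[f1 f2]].
have ab i j : i.+1 < n -> j.+1 < n ->
    (ent a i.+1 < ent a j.+1) = (ent b i < ent b j).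
  by move=> hi hj; rewrite e1 // e2 //; lia.
have ba i j : i.+1 < n -> j.+1 < n ->
    (ent b i.+1 < ent b j.+1) = (ent a i < ent a j).
  by move=> hi hj; rewrite f1 // f2 //; lia.
split.
  by apply/shift_invP => i j; rewrite !addn2 => hi hj; rewrite ab ?ba //; lia.
apply: contraNN nab => /shift_inv1_follows[s ha].
apply/eqP/(follows_unique ha)/signed_follows; apply: incr_lt => i hi.
rewrite signed_lt !ltz_nat.
(* The edge from [b] to [a] determines all neighbour comparisons in [b] except the first, which
   equals that of positions 1 and 2 in [a]. *)
case: i hi => [|i] hi; last rewrite !ba; last by lia.
- by rewrite -!ab ?ha ?signed_lt; case: (s) => //; lia.
- by rewrite !ha ?signed_lt; case: (s) => //; lia.
all: by lia.
Qed.

Lemma follows_edge (n : nat) (k : nat -> int) (a b : 'S_n) :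
  {in gtn n.+1 &, injective k} ->
  follows k a -> follows (fun i => k i.+1) b -> [exists e, is_edge e a b].
Proof.
move=> kI ha hb; have [e he] := follows_exists kI.
apply/existsP; exists e; apply/is_edgeP; split=> i j hi hj.
  by rewrite ha // he //; lia.
by rewrite hb // he.
Qed.

(** Take for [b] the window of [k] starting at 1; the window starting at 2 is again ordered like
    [a]. If [b] were [a], the order of [a] would be invariant under a shift by one. *)
Lemma follows_two_cycle (n : nat) (k : nat -> int) (a : 'S_n) :
  {in gtn n.+2 &, injective k} ->
  (forall i j, i < n -> j < n -> (k i.+2 < k j.+2)%R = (k i < k j)%R) ->
  follows k a -> a \notin shift_inv 1 n -> exists b, two_cycle a b.
Proof.
move=> kI k2 ha na.
have kSI : {in gtn n.+1 &, injective (fun i => k i.+1)}.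
  by move=> i j hi hj /kI/=; rewrite !inE => /(_ hi hj) [].
have [|b hb] := @follows_exists n (fun i => k i.+1).
  by move=> i j; rewrite !inE => hi hj; apply: kSI; rewrite inE ltnW.
exists b; apply/and3P; split.
- apply: contraNN na => /eqP ab; apply/shift_invP => i j; rewrite !addn1 => hi hj.
  by rewrite (ha i.+1 j.+1) // ab (hb i j) //; lia.
- by apply: follows_edge ha hb => i j; rewrite !inE => hi hj; apply: kI; rewrite inE ltnW.
- apply: follows_edge kSI hb _ => i j hi hj; rewrite ha //.
  by rewrite k2.
Qed.

(* For t < n both parity classes increase; the odd terms are raised by
   2 ((n-1)./2 - t) relative to the even ones, so that all n possible thresholds
   occur.  For t = n and t = n + 1 the even terms increase and the odd terms
   decrease, with all evens above, respectively below, all odds; the constant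
   n + 2 keeps this true for the n + 2 indices that a 2-cycle involves. *)
Definition key (n t i : nat) : int :=
  if t < n then Posz (i + if odd i then (n.-1)./2.*2 else t.*2)
  else if t == n then (if odd i then - i%:Z else i%:Z)%R
  else (if odd i then n.+2%:Z - i%:Z else i%:Z - n.+2%:Z)%R.

(** * The [key] sequences have distinct terms, shift-invariant orders, and pairwise different
    orders *)

Lemma signed_inj (s : bool) (m : nat) (k : nat -> int) :
  {in gtn m &, injective k} -> {in gtn m &, injective (signed s k)}.
Proof. by case: s => //= kI i j hi hj /oppr_inj; apply: kI. Qed.

Lemma key_inj (n t : nat) : {in gtn n.+2 &, injective (key n t)}.
Proof.
move=> i j; rewrite !inE /key => hi hj.
case: ifP => ht; last case: ifP => ht'; 
  case oi: (odd i); case oj: (odd j); lia.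
Qed.

Lemma key_shift2 (n t i j : nat) : i < n -> j < n ->
  (key n t i.+2 < key n t j.+2)%R = (key n t i < key n t j)%R.
Proof.
move=> hi hj; rewrite /key /= !negbK.
by case: ifP => ht; last case: ifP => ht';
  case oi: (odd i); case oj: (odd j); lia.
Qed.

Lemma signed_key_inj (n t t' : nat) (s s' : bool) : 3 < n -> t < n.+2 -> t' < n.+2 ->
  (forall i j, i < n -> j < n -> (signed s (key n t) i < signed s (key n t) j)%R
     = (signed s' (key n t') i < signed s' (key n t') j)%R) ->
  s = s' /\ t = t'.
Proof.
move=> n4 ht ht' H.
have {H}[es H] : s = s' /\ (forall i j, i < n -> j < n ->
    (key n t i < key n t j)%R = (key n t' i < key n t' j)%R).
  have up u : (key n u 0 < key n u 2)%R by rewrite /key /=; case: ifP => _; last case: ifP => _; lia.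
  have down u : (key n u 2 < key n u 0)%R = false by apply/lt_gtF/up.
  have e : s = s'.
    have := H 0 2 _ _; rewrite !signed_lt !up !down.
    by case: s s' {H} => -[] // H; have := H _ _; lia.
  split=> // i j hi hj; subst s'; have := H i j hi hj; have := H j i hj hi.
  by rewrite !signed_lt; case: (s).
split=> //; clear s s' es.
wlog tt : t t' ht ht' H / t < t'.
  move=> W; case: (ltngtP t t') => // tt; first exact: W.
  by apply/esym/W => // i j hi hj; rewrite H.
exfalso; case: (ltnP t' n) => h'.
  (* At this pair the odd key exceeds the even one by exactly 1 for [t]; any larger threshold raises
     the even key by at least 2 and reverses the comparison. *)
  have := H ((n.-1)./2 - t).*2 (t - (n.-1)./2).*2.+1.
  by rewrite /key h' (ltn_trans tt h') /= !odd_double /=; lia.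
have {}h' : (t' < n) = false by lia.
case h : (t < n).
  (* Odd terms increase for [t < n] and decrease for [t']; position 3 exists because [3 < n]. *)
  by have := H 1 3; rewrite /key h h' /=; case: ifP; lia.
have tn : t == n by lia.
have tn' : (t' == n) = false by lia.
by have := H 0 1; rewrite /key h h' tn tn' /=; lia.
Qed.

(** * Classification of the orders invariant under a shift by two *)

Lemma key_classification (n : nat) (x : nat -> int) : 3 < n ->
  {in gtn n &, injective x} ->
  (forall i j, i.+2 < n -> j.+2 < n -> (x i.+2 < x j.+2)%R = (x i < x j)%R) ->
  (x 0 < x 2)%R ->
  exists2 t, t < n.+2 &
    forall i j, i < n -> j < n -> (x i < x j)%R = (key n t i < key n t j)%R.
Proof.
move=> n4 xI x2 x02.
have shift m i j : i + m.*2 < n -> j + m.*2 < n ->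
    (x (i + m.*2)%N < x (j + m.*2)%N)%R = (x i < x j)%R.
  elim: m => [|m IH]; rewrite ?addn0 // doubleS !addnS => hi hj.
  by rewrite x2 // IH //; lia.
have evens u v : u.*2 < n -> v.*2 < n -> (x u.*2 < x v.*2)%R = (u < v).
  move=> hu hv; apply: (@incr_lt ((n.+1)./2) (fun u => x u.*2)); try lia.
  move=> i hi; rewrite doubleS.
  by have := shift i 0 2; rewrite x02 add0n add2n => -> //; lia.
have odds_step u : u.*2.+3 < n ->
    (x u.*2.+1 < x u.*2.+3)%R = (x 1%N < x 3%N)%R.
  by move=> hu; have := shift u 1 3; rewrite add1n !addSn add0n => -> //; lia.
have total i j : i < n -> j < n -> i != j -> (x j < x i)%R = ~~ (x i < x j)%R.
  move=> hi hj ij; rewrite -leNgt lt_neqAle.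
  suff -> : x j != x i by [].
  by apply: contraNneq ij => /xI -> //.
have parity i : exists u, i = if odd i then u.*2.+1 else u.*2.
  by exists i./2; have := odd_double_half i; case: odd => /=; lia.
(* Evens increase in every [key], and odd-even comparisons negate even-odd ones, so only two kinds
   of pairs depend on the case. *)
have reduce t : t < n.+2 ->
    (forall u v, u.*2.+1 < n -> v.*2.+1 < n ->
       (x u.*2.+1 < x v.*2.+1)%R = (key n t u.*2.+1 < key n t v.*2.+1)%R) ->
    (forall u v, u.*2 < n -> v.*2.+1 < n ->
       (x u.*2 < x v.*2.+1)%R = (key n t u.*2 < key n t v.*2.+1)%R) ->
    exists2 t, t < n.+2 &
      forall i j, i < n -> j < n -> (x i < x j)%R = (key n t i < key n t j)%R.
  move=> ht oo eo; exists t => // i j.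
  have [u] := parity i; have [v] := parity j.
  case: (odd i); case: (odd j) => -> -> hi hj.
  - exact: oo.
  - rewrite total ?eo //; last by lia.
    rewrite -leNgt lt_neqAle; suff -> : key n t u.*2.+1 != key n t v.*2 by [].
    by apply/eqP => /key_inj; rewrite !inE; lia.
  - exact: eo.
  - rewrite evens // /key !odd_double; case: ifP => _; last case: ifP => _; lia.
case: (ltP (x 1%N) (x 3%N)) => x13.
- (* [g d] compares positions 2u and 2v + 1 with d = v - u + h; the truncated
     subtractions pick the pair with u = 0 or v = 0. *)
  pose h := (n.-1)./2; pose g d := (x (h - d).*2 < x (d - h).*2.+1)%R.
  (* Raising [d] by one either lowers the even position or raises the odd one by two; both preserve
     the inequality. *)
  have gS d : d.+1 < n.-1 -> g d -> g d.+1.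
    rewrite /g => hd; case: (leqP h d) => hdh.
      have -> : h - d.+1 = h - d by lia.
      have -> : d.+1 - h = (d - h).+1 by lia.
      move=> /lt_trans; apply; rewrite doubleS odds_step //; lia.
    have -> : d.+1 - h = d - h by lia.
    apply: lt_trans; rewrite evens; lia.
  have gmono d e : d <= e -> e < n.-1 -> g d -> g e.
    elim: e => [|e IH]; first by rewrite leqn0 => /eqP ->.
    rewrite leq_eqVlt => /orP[/eqP -> //|de] he gd.
    by apply: gS => //; apply: IH => //; apply: ltnW.
  (* The threshold is the first [d] at which [g] holds; if there is none, [find] returns [n.-1],
     which is the last of the n values. *)
  pose t := find g (iota 0 n.-1).
  have tn : t <= n.-1 by rewrite -[X in _ <= X](size_iota 0); apply: find_size.
  have gt d : d < n.-1 -> g d = (t <= d).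
    move=> hd; apply/idP/idP => [gd|td].
      rewrite leqNgt; apply/negP => dt.
      by have := before_find 0 dt; rewrite nth_iota // gd.
    apply: (gmono _ _ td hd).
    have ht : has g (iota 0 n.-1) by rewrite has_find size_iota; apply: leq_ltn_trans hd.
    by have := nth_find 0 ht; rewrite nth_iota //; apply: leq_ltn_trans hd.
  have tn' : t < n by lia.
  apply: (reduce t); first by lia.
    move=> u v hu hv; rewrite /key tn' /= !odd_double /=.
    rewrite (@incr_lt n./2 (fun u => x u.*2.+1)); try lia.
    by move=> i hi; rewrite doubleS odds_step //; lia.
  move=> u v hu hv; rewrite /key tn' /= !odd_double /= -/h.
  have := gt (v + h - u); rewrite /g.
  (* Shifting back by [2 * p] brings the pair to one with u = 0 or v = 0, as tested by [g]. *)
  set p := minn u v.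
  have := shift p (h - (v + h - u)).*2 (v + h - u - h).*2.+1.
  have -> : (h - (v + h - u)).*2 + p.*2 = u.*2 by lia.
  have -> : (v + h - u - h).*2.+1 + p.*2 = v.*2.+1 by lia.
  move=> -> // -> ; lia.
have {}x31 : (x 3%N < x 1%N)%R.
  by rewrite total ?ltNge ?negbK //; lia.
have odds u v : u.*2.+1 < n -> v.*2.+1 < n ->
    (x u.*2.+1 < x v.*2.+1)%R = (v < u).
  move=> hu hv.
  rewrite -(@incr_lt n./2 (fun u => - x u.*2.+1)%R) ?ltrN2 //; try lia.
  move=> i hi; rewrite ltrN2 doubleS total ?odds_step ?ltNge ?(ltW x31) //; lia.
case: (ltP (x 0%N) (x 1%N)) => x01.
  have diag u : u.*2.+1 < n -> (x u.*2 < x u.*2.+1)%R.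
    by move=> hu; have := shift u 0 1; rewrite x01 add0n add1n => -> //; lia.
  (* Induction: shifting [x u.*2 < x 1] by two gives a bound by [x 3], which lies below [x 1]. *)
  have base u : u.*2 < n -> (x u.*2 < x 1%N)%R.
    elim: u => [//|u IH] hu; apply: lt_trans x31.
    by rewrite doubleS x2 ?IH //; lia.
  have nF : (n.+1 < n) = false by lia.
  have nE : (n.+1 == n) = false by lia.
  apply: (reduce n.+1) => [//|u v hu hv|u v hu hv].
    by rewrite odds // /key /= !odd_double nF nE /=; lia.
  have -> : (x u.*2 < x v.*2.+1)%R.
    case: (leqP u v) => uv.
      rewrite (le_lt_trans _ (diag v hv)) // leNgt evens //; lia.
    have := shift v (u - v).*2 1; rewrite base; last by lia.
    have -> : (u - v).*2 + v.*2 = u.*2 by lia.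
    by rewrite add1n => ->.
  by rewrite /key /= !odd_double nF nE /=; lia.
have {}x10 : (x 1%N < x 0%N)%R.
  by rewrite total ?ltNge ?negbK //; lia.
apply: (reduce n) => [//|u v hu hv|u v hu hv].
  by rewrite odds // /key /= !odd_double ltnn eqxx /=; lia.
(* Every odd term is at most [x 1], and every even term is at least [x 0]. *)
have -> : (x u.*2 < x v.*2.+1)%R = false.
  apply/lt_gtF/(@le_lt_trans _ _ (x 1%N)).
    by rewrite leNgt (odds 0 v) //; lia.
  by apply: (lt_le_trans x10); rewrite leNgt (evens u 0) //; lia.
by rewrite /key /= !odd_double ltnn eqxx /=; lia.
Qed.

Lemma shift_inv2_follows (n : nat) (a : 'S_n) : 3 < n -> a \in shift_inv 2 n ->
  exists s, exists2 t, t < n.+2 & follows (signed s (key n t)) a.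
Proof.
move=> n4 /shift_invP inv2.
pose s := ent a 2 < ent a 0; pose x := signed s (fun i => ent a i).
have xI : {in gtn n &, injective x}.
  apply: signed_inj => i j hi hj []; exact: ent_inj.
have x2 i j : i.+2 < n -> j.+2 < n -> (x i.+2 < x j.+2)%R = (x i < x j)%R.
  move=> hi hj; rewrite !signed_lt !ltz_nat.
  by have := inv2 i j; have := inv2 j i; rewrite !addn2 => -> // ->.
have x02 : (x 0 < x 2)%R.
  rewrite signed_lt !ltz_nat /s.
  case: (ltngtP (ent a 2) (ent a 0)) => // e.
  suff : 2 = 0 by [].
  by apply: ent_inj e; lia.
have [t ht xt] := key_classification n4 xI x2 x02.
by exists s, t => //; apply: signed_follows.
Qed.

(** * Counting the invariant permutations *)

(** A function of [k] is needed to parametrize permutations by sign and threshold; the default 1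
    occurs only if [k] repeats a value among its first n terms. *)
Definition pattern (n : nat) (k : nat -> int) : 'S_n :=
  odflt 1%g [pick a : 'S_n | [forall i : 'I_n, forall j : 'I_n,
    (ent a i < ent a j) == (k i < k j)%R]].

Lemma pattern_follows (n : nat) (k : nat -> int) :
  {in gtn n &, injective k} -> follows k (pattern n k).
Proof.
move=> kI; rewrite /pattern; case: pickP => [a /forallP ha|no] /=.
  move=> i j hi hj; have /forallP/(_ (Ordinal hj)) := ha (Ordinal hi).
  by move=> /eqP.
have [a ha] := follows_exists kI; case/negP: (negbT (no a)).
by apply/forallP => i; apply/forallP => j; rewrite ha.
Qed.

Lemma signed_key_inj_in (n t m : nat) (s : bool) : m <= n.+2 ->
  {in gtn m &, injective (signed s (key n t))}.
Proof.
move=> hm; apply: signed_inj => i j; rewrite !inE => hi hj.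
by apply: key_inj; rewrite inE (leq_trans _ hm).
Qed.

Lemma signed_key_shift2 (n t i j : nat) (s : bool) : i < n -> j < n ->
  (signed s (key n t) i.+2 < signed s (key n t) j.+2)%R
  = (signed s (key n t) i < signed s (key n t) j)%R.
Proof. by move=> hi hj; rewrite !signed_lt !key_shift2. Qed.

Lemma card_shift_inv2 (n : nat) : 3 < n -> #|shift_inv 2 n| = 2 * n.+2.
Proof.
move=> n4; pose f (p : bool * 'I_n.+2) := pattern n (signed p.1 (key n p.2)).
have hf (p : bool * 'I_n.+2) : follows (signed p.1 (key n p.2)) (f p).
  by apply/pattern_follows/signed_key_inj_in; lia.
have fI : injective f.
  move=> [s t] [s' t'] e.
  have [|-> /val_inj ->] // := @signed_key_inj n t t' s s' n4 (ltn_ord t) (ltn_ord t').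
  by move=> i j hi hj; rewrite -(hf (s, t)) // e (hf (s', t')).
suff -> : shift_inv 2 n = f @: setT.
  by rewrite card_imset // cardsT card_prod card_bool card_ord.
apply/setP => a; apply/idP/imsetP => [/(shift_inv2_follows n4)[s [t ht ha]]|[p _ ->]].
  by exists (s, Ordinal ht) => //; apply: follows_unique ha (hf (s, Ordinal ht)).
apply: follows_shift_inv (hf p) => i j; rewrite !addn2 => hi hj.
by apply: signed_key_shift2; lia.
Qed.

Lemma follows_signed_shift1 (n : nat) (s : bool) (a : 'S_n) :
  follows (signed s Posz) a -> a \in shift_inv 1 n.
Proof.
by apply: follows_shift_inv => i j _ _; rewrite !signed_lt; case: s; lia.
Qed.

Lemma card_shift_inv1 (n : nat) : 1 < n -> #|shift_inv 1 n| = 2.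
Proof.
move=> n2; pose f s := pattern n (signed s Posz).
have hf s : follows (signed s Posz) (f s).
  by apply/pattern_follows/signed_inj => i j _ _ [].
have fI : injective f.
  move=> s s' e; have := hf s 0 1; rewrite e hf ?signed_lt; try lia.
  by case: s s' {e} => -[] //=; lia.
suff -> : shift_inv 1 n = f @: setT by rewrite card_imset // cardsT card_bool.
apply/setP => a; apply/idP/imsetP => [/shift_inv1_follows[s ha]|[s _ ->]].
  by exists s => //; apply: follows_unique ha (hf s).
exact: follows_signed_shift1 (hf s).
Qed.

Lemma shift_inv1_sub2 (n : nat) : shift_inv 1 n \subset shift_inv 2 n.
Proof.
apply/subsetP => a /shift_inv1_follows[s]; apply: follows_shift_inv => i j _ _.
by rewrite !signed_lt; case: s; lia.
Qed.

Lemma two_cycle_vertices (n : nat) : 3 < n ->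
  [set a : 'S_n | [exists b, two_cycle a b]] = shift_inv 2 n :\: shift_inv 1 n.
Proof.
move=> n4; apply/setP => a; rewrite inE in_setD.
apply/existsP/andP => [[b /(two_cycle_shift_inv (ltnW n4))[]]//|[na]].
move=> /(shift_inv2_follows n4)[s [t _ ha]].
apply: follows_two_cycle ha na; first exact: signed_key_inj_in.
by move=> i j; apply: signed_key_shift2.
Qed.

Theorem theorem4p1 (n : nat) (hn : 4 <= n) : v2 n = 2 * n + 2.
Proof.
rewrite /v2 two_cycle_vertices // cardsD.
have /setIidPr -> := shift_inv1_sub2 n.
by rewrite card_shift_inv2 // card_shift_inv1; lia.
Qed.
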